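(* Let $n\ge 1$ and let $$M_{2n}=\begin{pmatrix} T_n & D_n\\ D_n & T_n\end{pmatrix},$$ where $T_n$ is the $n\times n$ real symmetric tridiagonal matrix whose sub- and superdiagonal entries are all equal to $1$ and whose diagonal entries are all equal to a common value $\tau\in\{0,1\}$, and $D_n$ is a real diagonal matrix with diagonal entries $d_1,\ldots,d_n$ satisfying $d_j=-d_{n-j+1}$ for $j=1,2,\ldots,\lceil \frac n2\rceil$. Let $G$ be a graph with $M_{2n}\in S(G)$. Then $\mathrm{Mm}(G)=2$.
   Context: Graphs are finite, simple and undirected. For a graph $G$ with vertex set $\{1,\ldots,N\}$, $S(G)$ is the set of all real symmetric $N\times N$ matrices $A=(a_{ij})$ such that, for $i\ne j$, $a_{ij}\neq 0$ if and only if $\{i,j\}$ is an edge of $G$; there is no restriction on the diagonal entries. $\mathrm{Mm}(A)$ is the minimal multiplicity among the eigenvalues of $A$, and $\mathrm{Mm}(G)=\max\{\mathrm{Mm}(A): A\in S(G)\}$. *)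

(* Defs.v *)
From mathcomp Require Import all_boot all_order all_algebra.
From mathcomp Require Import reals.

Set Implicit Arguments.
Unset Strict Implicit.
Unset Printing Implicit Defensive.

Import Order.TTheory GRing.Theory Num.Theory.
Local Open Scope ring_scope.

Record sgraph (N : nat) := SGraph {
  adj :> rel 'I_N;
  adj_sym : symmetric adj;
  adj_irrefl : irreflexive adj
}.

Definition is_min (P : nat -> Prop) (m : nat) : Prop :=
  P m /\ forall k, P k -> (m <= k)%N.

Definition is_max (P : nat -> Prop) (m : nat) : Prop :=
  P m /\ forall k, P k -> (k <= m)%N.

Section InverseEigenvalue.
Variable R : realType.

(* The class S(G); the diagonal of A is unconstrained. *)
Definition in_S (N : nat) (G : sgraph N) (A : 'M[R]_N) : Prop :=
  A^T = A /\ forall i j : 'I_N, i != j -> (A i j != 0) = G i j.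

Definition eig_mult (N : nat) (A : 'M[R]_N) (a : R) : nat :=
  mup a (char_poly A).

(* mx_Mm A m : Mm(A) = m.  Only real eigenvalues are considered, which are all
   the eigenvalues of the symmetric matrices this is applied to. *)
Definition mx_Mm (N : nat) (A : 'M[R]_N) (m : nat) : Prop :=
  is_min (fun k => exists2 a : R, eigenvalue A a & eig_mult A a = k) m.

(* graph_Mm G m : Mm(G) = m. *)
Definition graph_Mm (N : nat) (G : sgraph N) (m : nat) : Prop :=
  is_max (fun k => exists2 A : 'M[R]_N, in_S G A & mx_Mm A k) m.

Definition tridiag (n : nat) (tau : R) : 'M[R]_n :=
  \matrix_(i < n, j < n)
    if i == j then tau
    else if (i.+1 == j :> nat) || (j.+1 == i :> nat) then 1 else 0.

Definition M2n (n : nat) (tau : R) (d : 'rV[R]_n) : 'M[R]_(n + n) :=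
  block_mx (tridiag n tau) (diag_mx d) (diag_mx d) (tridiag n tau).

End InverseEigenvalue.

Arguments graph_Mm R {N} G m.

(* Main.v *)
Require Import Defs.
From mathcomp Require Import all_boot all_order all_algebra.
From mathcomp Require Import reals.
From mathcomp Require Import fingroup perm complex zify.

Set Implicit Arguments.
Unset Strict Implicit.
Unset Printing Implicit Defensive.

(** The graph G is a ladder: two paths on n vertices, with some of the rungs
    joining the j-th vertex of one path to the j-th vertex of the other.

    Write T and D for the blocks of M2n tau d.

    Upper bound.  Take A in S(G) and an eigenvector v of A vanishing at the
    first vertex of each path.  The coordinate of v A = a v at the k-th vertex
    of a path involves, besides coordinates already known to vanish, only the
    coordinate of v at the next vertex of that path, with a nonzero
    coefficient; so v vanishes rung after rung, hence everywhere (the two first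
    vertices form a zero forcing set).  Each eigenspace of A therefore embeds
    in R^2 (ladder_eigenvector_eq0, rank_le2_of_two_zeros).  As A is
    real symmetric, hence diagonalizable, algebraic multiplicities are at most 2
    as well (symmetric_mup_le_eigenspace).

    Lower bound.  The matrix M2n tau d itself is extremal.  Adding and
    subtracting the two blocks shows that its characteristic polynomial is the
    product of those of T + D and T - D.  Reversing the order of the indices
    fixes T and negates D, so T + D and T - D are similar and the product is a
    square (char_poly_M2n): every multiplicity is even.  Together with the upper
    bound, every eigenvalue of M2n tau d has multiplicity exactly 2, and a real
    symmetric matrix of positive size does have an eigenvalue. *)

Import Order.TTheory GRing.Theory Num.Theory.
Local Open Scope ring_scope.

(** * Similarity and characteristic polynomials *)

Lemma char_poly_similar (R : comNzRingType) (n : nat) (P Q B : 'M[R]_n) :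
  Q *m P = 1%:M -> char_poly (Q *m B *m P) = char_poly B.
Proof.
move=> QP; rewrite /char_poly.
have QPX : map_mx polyC Q *m map_mx polyC P = 1%:M.
  by rewrite -map_mxM QP map_mx1.
have -> : char_poly_mx (Q *m B *m P)
    = map_mx polyC Q *m char_poly_mx B *m map_mx polyC P.
  rewrite /char_poly_mx mulmxBr mulmxBl !map_mxM; congr (_ - _).
  by rewrite mul_mx_scalar -scalemxAl QPX scalemx1.
rewrite !det_mulmx mulrAC -det_mulmx QPX det1 mul1r //.
Qed.

(** Conjugating by a unipotent block matrix makes the matrix block triangular
    with diagonal blocks A + B and A - B.  The orthogonal change of basis to sums
    and differences would make it block diagonal, but it divides by 2. *)
Lemma char_poly_block_swap (R : comNzRingType) (n : nat) (A B : 'M[R]_n) :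
  char_poly (block_mx A B B A) = char_poly (A + B) * char_poly (A - B).
Proof.
pose L : 'M[R]_(n + n) := block_mx 1%:M (- 1%:M) 0 1%:M.
pose K : 'M[R]_(n + n) := block_mx 1%:M 1%:M 0 1%:M.
have KL : K *m L = 1%:M.
  rewrite mulmx_block !(mul1mx, mulmx1, mul0mx, mulmx0, addr0, add0r) addNr.
  by rewrite -scalar_mx_block.
rewrite -(char_poly_similar (block_mx A B B A) KL) !mulmx_block.
rewrite !(mul1mx, mulmx1, mulmx0, mul0mx, addr0, add0r, mulmxN).
rewrite [B + A]addrC addNr [- B + A]addrC.
rewrite /char_poly /char_poly_mx map_block_mx scalar_mx_block opp_block_mx.
by rewrite add_block_mx map_mx0 subrr det_lblock.
Qed.

(** * Spectra of real symmetric matrices *)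

(** The change of basis P is complex because the spectral theorem applied here
    is the one for normal matrices over R[i]; a symmetric real matrix is
    Hermitian, so the diagonal D is nevertheless real. *)
Lemma symmetric_diagonalizable (R : rcfType) (n : nat) (A : 'M[R]_n) :
  A^T = A ->
  exists (P : 'M[R[i]]_n) (D : 'rV[R]_n), P \in unitmx /\
    map_mx (real_complex R) A =
      invmx P *m map_mx (real_complex R) (diag_mx D) *m P.
Proof.
move=> symA; set AC := map_mx _ A.
have realAC : AC \is a mxOver Num.real.
  by apply/mxOverP => i j; rewrite mxE; apply/complex_realP; exists (A i j).
have symAC : AC \is symmetricmx.
  by apply/is_hermitianmxP; rewrite expr0 scale1r map_mx_id // map_trmx symA.
have /orthomx_spectralP ACE := symmetric_normalmx symAC realAC.
have /mxOverP realD :=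
  hermitian_spectral_diag_real (realsym_hermsym symAC realAC).
exists (spectralmx AC), (map_mx (@complex.Re R) (spectral_diag AC)).
split; first exact: spectral_unit.
rewrite {1}ACE; congr (_ *m _ *m _).
by apply/matrixP => i j; rewrite !mxE raddfMn /= RRe_real.
Qed.

(** The real trace left by the complex diagonalization: characteristic
    polynomials and ranks do not change under field extension, so P can be
    forgotten and only the real eigenvalues D are kept. *)
Lemma symmetric_spectrum (R : rcfType) (n : nat) (A : 'M[R]_n) :
  A^T = A ->
  exists D : 'rV[R]_n, char_poly A = \prod_i ('X - (D 0 i)%:P) /\
    forall a, (\rank (A - a%:M)%R <= #|[pred i | D 0%R i != a]|)%N.
Proof.
move=> /symmetric_diagonalizable[P [D [Pu AE]]]; exists D; split=> [|a].
  apply: (map_poly_inj (real_complex R)); rewrite map_char_poly AE.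
  rewrite char_poly_similar ?mulVmx // -map_char_poly char_poly_trig.
    by congr map_poly; apply: eq_bigr => i _; rewrite mxE eqxx.
  by apply/is_trig_mxP => i j ij; rewrite mxE (_ : i == j = false) // -val_eqE ltn_eqF.
rewrite -(mxrank_map (real_complex R)) map_mxB AE map_scalar_mx.
have -> : invmx P *m map_mx (real_complex R) (diag_mx D) *m P - (a%:C)%C%:M
    = invmx P *m map_mx (real_complex R) (diag_mx (D - const_mx a)) *m P.
  rewrite linearB /= diag_const_mx map_mxB mulmxBr mulmxBl; congr (_ - _).
  by rewrite map_scalar_mx mul_mx_scalar -scalemxAl mulVmx // scalemx1.
rewrite (leq_trans (mxrankM_maxl _ _)) // (leq_trans (mxrankM_maxr _ _)) //.
(* A diagonal matrix is a sum of matrices of rank at most one, one for each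
   nonzero diagonal entry. *)
rewrite mxrank_map diag_mx_sum_delta (bigID (fun i => D 0 i == a)) /=.
rewrite big1 ?add0r; last by move=> i /eqP Di; rewrite !mxE Di subrr scale0r.
rewrite -sum1_card.
elim/big_rec2: _ => [|i k M _ leM]; first by rewrite mxrank0.
apply: leq_trans (mxrank_add _ _) _; rewrite leq_add //.
by rewrite (leq_trans (mxrank_scale _ _)) // mxrank_delta.
Qed.

Lemma mup_prod_XsubC (F : fieldType) (I : finType) (r : I -> F) (a : F) :
  mup a (\prod_i ('X - (r i)%:P)) = #|[pred i | r i == a]|.
Proof.
(* mupM needs nonzero factors, so nonvanishing is carried along the
   induction. *)
pose K p m := p != 0 /\ mup a p = m.
suff [] : K (\prod_i ('X - (r i)%:P)) (\sum_i (r i == a))%N.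
  by rewrite -sum1_card [in X in _ -> _ -> _ = X]big_mkcond => _ ->.
apply: (big_rec2 K) => [|i m p _ [p0 <-]]; split.
- exact: oner_neq0.
- by rewrite mupNroot // rootE hornerC oner_neq0.
- by rewrite mulf_neq0 // polyXsubC_eq0.
- by rewrite mupM ?polyXsubC_eq0 // -[X in mup a X]expr1 mup_XsubCX.
Qed.

(** If a occurs k times among the n eigenvalues, then A - a has rank at most
    n - k, so its kernel has dimension at least k. *)
Lemma symmetric_mup_le_eigenspace (R : rcfType) (n : nat) (A : 'M[R]_n) a :
  A^T = A -> (mup a (char_poly A) <= \rank (eigenspace A a))%N.
Proof.
move=> /symmetric_spectrum[D [-> rkA]].
rewrite mup_prod_XsubC mxrank_ker leq_subRL ?rank_leq_row //.
apply: leq_trans (leq_add (rkA a) (leqnn _)) _.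
by rewrite addnC cardC card_ord.
Qed.

Lemma symmetric_has_eigenvalue (R : rcfType) (n : nat) (A : 'M[R]_n) :
  (0 < n)%N -> A^T = A -> exists a, eigenvalue A a.
Proof.
move=> n_gt0 /symmetric_spectrum[D [pE _]].
exists (D 0 (Ordinal n_gt0)); rewrite eigenvalue_root_char pE.
by rewrite (bigD1 (Ordinal n_gt0)) //= rootM root_XsubC eqxx.
Qed.

(** * Zero forcing on the ladder *)

(** Evaluation at the coordinates i and j is an injective linear map from the
    row space of V to the plane. *)
Lemma rank_le2_of_two_zeros (F : fieldType) (m n : nat) (V : 'M[F]_(m, n))
    (i j : 'I_n) :
  (forall v : 'rV_n, (v <= V)%MS -> v 0 i = 0 -> v 0 j = 0 -> v = 0) ->
  (\rank V <= 2)%N.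
Proof.
move=> Vij; pose f : 'M[F]_(n, 1 + 1) := row_mx (delta_mx i 0) (delta_mx j 0).
suff /mxrank_injP <- : (V :&: kermx f)%MS == 0 by apply: rank_leq_col.
rewrite -submx0; apply/rV_subP => v; rewrite sub_capmx => /andP[vV /sub_kermxP].
rewrite mul_mx_row -[RHS]row_mx0 => /eq_row_mx[vi vj].
rewrite (Vij v) ?sub0mx //.
  by move: vi; rewrite -colE => /matrixP/(_ 0 0); rewrite !mxE.
by move: vj; rewrite -colE => /matrixP/(_ 0 0); rewrite !mxE.
Qed.

(** The colour change rule of zero forcing: in the coordinate i of v A = a v the
    only term that can survive is v k * A k i, and A k i is nonzero because
    {i, k} is an edge. *)
Lemma eigenvector_forced_zero (R : realType) (N : nat) (G : sgraph N)
    (A : 'M[R]_N) (a : R) (v : 'rV[R]_N) (i k : 'I_N) :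
  in_S G A -> v *m A = a *: v -> G i k -> v 0 i = 0 ->
  (forall j, G i j -> j != k -> v 0 j = 0) -> v 0 k = 0.
Proof.
move=> [_ GA] vA Gik vi vN.
have ki : k != i by apply: contraTneq Gik => ->; rewrite adj_irrefl.
have := congr1 (fun M : 'rV[R]_N => M 0 i) vA.
rewrite !mxE vi mulr0 (bigD1 k) //= big1 ?addr0 => [|j jk].
  move/eqP; rewrite mulf_eq0 => /orP[/eqP //|].
  by rewrite (negPf (_ : A k i != 0)) // GA // adj_sym.
have [->|ji] := eqVneq j i; first by rewrite vi mul0r.
have [Aji0|/[!GA] // Gji] := eqVneq (A j i) 0; first by rewrite Aji0 mulr0.
by rewrite vN ?mul0r // adj_sym.
Qed.

Lemma tridiag_adj (R : realType) (n : nat) (tau : R) (i j : 'I_n) :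
  i != j -> (tridiag n tau i j != 0) = (i.+1 == j :> nat) || (j.+1 == i :> nat).
Proof.
by move=> /negPf ij; rewrite mxE ij; case: ifP; rewrite ?oner_neq0 ?eqxx.
Qed.

(** Each rung forces the next one: once both paths carry zeros up to the k-th
    vertex, the only possibly nonzero neighbour of the k-th vertex of a path is
    its successor on the same path. *)
Lemma ladder_eigenvector_eq0 (R : realType) (n : nat) (hn : (0 < n)%N)
    (tau : R) (d : 'rV[R]_n) (G : sgraph (n + n)) (A : 'M[R]_(n + n)) (a : R)
    (v : 'rV[R]_(n + n)) :
  in_S G (M2n tau d) -> in_S G A -> v *m A = a *: v ->
  v 0 (lshift n (Ordinal hn)) = 0 -> v 0 (rshift n (Ordinal hn)) = 0 -> v = 0.
Proof.
move=> [_ GM] GA vA vl vr.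
have Gll (i j : 'I_n) : G (lshift n i) (lshift n j) =
    (i.+1 == j :> nat) || (j.+1 == i :> nat).
  have [->|ij] := eqVneq i j.
    by rewrite adj_irrefl orbb eqn_leq ltnn.
  by rewrite -GM ?eq_lshift // block_mxEul tridiag_adj.
have Grr (i j : 'I_n) : G (rshift n i) (rshift n j) =
    (i.+1 == j :> nat) || (j.+1 == i :> nat).
  have [->|ij] := eqVneq i j.
    by rewrite adj_irrefl orbb eqn_leq ltnn.
  by rewrite -GM ?eq_rshift // block_mxEdr tridiag_adj.
have Glr (i j : 'I_n) : G (lshift n i) (rshift n j) -> i = j.
  rewrite -GM ?eq_lrshift // block_mxEur mxE; case: (eqVneq i j) => // _.
  by rewrite mulrb eqxx.
suff v0 k : forall i : 'I_n, (i <= k)%N ->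
    v 0 (lshift n i) = 0 /\ v 0 (rshift n i) = 0.
  apply/rowP => i; rewrite mxE; case: (split_ordP i) => j ->;
  by have [] := v0 j j (leqnn j).
elim: k => [|k IH] i.
  by rewrite leqn0 => /eqP i0; rewrite (_ : i = Ordinal hn) //; apply/val_inj.
rewrite leq_eqVlt => /predU1P[ik|]; last exact: IH.
have kn : (k < n)%N by rewrite (leq_trans _ (ltn_ord i)) // ik.
pose k' := Ordinal kn.
have nb (j : 'I_n) : (k'.+1 == j :> nat) || (j.+1 == k' :> nat) -> j != i ->
    (j <= k)%N.
  rewrite -(inj_eq (@ord_inj n)) ik => /orP[/= /eqP<-|/= /eqP<- _]; last exact: leqnSn.
  by rewrite eqxx.
have [vkl vkr] := IH k' (leqnn k).
split.
- apply: (eigenvector_forced_zero GA vA (i := lshift n k')) => //.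
    by rewrite Gll ik eqxx.
  move=> j; case: (split_ordP j) => {}j -> Gj ji.
    have /IH[] // : (j <= k)%N by rewrite nb -?Gll // -(eq_lshift n).
  by rewrite -(Glr _ _ Gj).
- apply: (eigenvector_forced_zero GA vA (i := rshift n k')) => //.
    by rewrite Grr ik eqxx.
  move=> j; case: (split_ordP j) => {}j -> Gj ji.
    by move: Gj; rewrite adj_sym => /Glr ->.
  have /IH[] // : (j <= k)%N by rewrite nb -?Grr // -(eq_rshift n).
Qed.

Lemma ladder_mult_le2 (R : realType) (n : nat) (tau : R) (d : 'rV[R]_n)
    (G : sgraph (n + n)) (A : 'M[R]_(n + n)) (a : R) :
  (0 < n)%N -> in_S G (M2n tau d) -> in_S G A -> (eig_mult A a <= 2)%N.
Proof.
move=> hn GM GA; apply: leq_trans (symmetric_mup_le_eigenspace a GA.1) _.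
apply: (@rank_le2_of_two_zeros _ _ _ _ (lshift n (Ordinal hn))
  (rshift n (Ordinal hn))) => v /eigenspaceP vA.
exact: ladder_eigenvector_eq0 GM GA vA.
Qed.

(** * The matrix with doubled spectrum *)

(** The reversal of the indices conjugates T + D into T - D, because a
    tridiagonal Toeplitz matrix is symmetric about its antidiagonal while d is
    antisymmetric. *)
Lemma char_poly_M2n (R : realType) (n : nat) (tau : R) (d : 'rV[R]_n) :
  (forall j, d 0 j = - d 0 (rev_ord j)) ->
  char_poly (M2n tau d) = char_poly (tridiag n tau + diag_mx d) ^+ 2.
Proof.
move=> d_anti; rewrite char_poly_block_swap expr2; congr (_ * _).
pose s := perm (@rev_ord_inj n).
have ss : (perm_mx s : 'M[R]_n) *m perm_mx s = 1%:M.
  rewrite -perm_mxM (_ : (s * s)%g = 1%g) ?perm_mx1 //.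
  by apply/permP => i; rewrite permM !permE rev_ordK.
rewrite -(char_poly_similar (tridiag n tau + diag_mx d) ss).
have {2}-> : s = (s^-1)%g.
  by apply/permP => i; apply: (perm_inj (s := s)); rewrite permKV !permE rev_ordK.
rewrite -row_permE -col_permE; congr char_poly.
apply/matrixP => i j; rewrite !mxE !permE (inj_eq rev_ord_inj).
rewrite [in RHS]d_anti rev_ordK -mulNrn; congr (_ + _); case: eqVneq => // _.
congr (if _ then _ else _); rewrite /= orbC.
by have := ltn_ord i; have := ltn_ord j; lia.
Qed.

Theorem corollary5p2 (R : realType) (n : nat) (hn : (1 <= n)%N)
    (tau : R) (htau : tau = 0 \/ tau = 1)
    (d : 'rV[R]_n)
    (hd : forall j : 'I_n, (j < uphalf n)%N -> d 0 j = - d 0 (rev_ord j))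
    (G : sgraph (n + n)) (hG : in_S G (M2n tau d)) :
  graph_Mm R G 2.
Proof.
have le2 (A : 'M[R]_(n + n)) a : in_S G A -> (eig_mult A a <= 2)%N.
  exact: ladder_mult_le2 hn hG.
split; last by move=> k [A GA [[a _ <-] _]]; apply: le2.
(* uphalf n is the ceiling of n / 2, and the reversal sends the remaining
   indices below it, so the hypothesis extends to all of d. *)
have d_anti j : d 0 j = - d 0 (rev_ord j).
  have [/hd //|lej] := ltnP j (uphalf n).
  rewrite (hd (rev_ord j)) ?rev_ordK ?opprK //=.
  by have := ltn_ord j; lia.
have ge2 a : eigenvalue (M2n tau d) a -> (2 <= eig_mult (M2n tau d) a)%N.
  rewrite eigenvalue_root_char /eig_mult char_poly_M2n // expr2 rootM orbb => pa.
  have p0 : char_poly (tridiag n tau + diag_mx d) != 0.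
    by rewrite monic_neq0 ?char_poly_monic.
  by rewrite mupM // addnn -[2%N]/(1.*2) leq_double -XsubC_dvd // dvdp_XsubCl.
have [a Ma] : exists a, eigenvalue (M2n tau d) a.
  by apply: symmetric_has_eigenvalue hG.1; rewrite addn_gt0 hn.
exists (M2n tau d) => //; split.
  by exists a => //; apply/eqP; rewrite eqn_leq le2 ?ge2.
by move=> k [b Mb <-]; apply: ge2.
Qed.
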